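(* Consider $27$ real variables $x_{\kappa\kappa_A\kappa_B}$ indexed by $(\kappa,\kappa_A,\kappa_B)\in\{A,B,X\}^3$. Let $$T=\sum_{A\kappa_A\kappa_B\to B\lambda_A\lambda_B}x_{A\kappa_A\kappa_B}x_{B\lambda_A\lambda_B},\quad R=\sum_{\kappa A\kappa_B\to\lambda B\lambda_B}x_{\kappa A\kappa_B}x_{\lambda B\lambda_B},\quad S=\sum_{\kappa\kappa_A A\to\lambda\lambda_A B}x_{\kappa\kappa_A A}x_{\lambda\lambda_A B},$$ and for $\mu\in\{A,B,X\}$ let $s_\mu=\sum_{\kappa_A,\kappa_B\in\{A,B,X\}}x_{\mu\kappa_A\kappa_B}$. Then the maximum of $$s_X\,T+s_A\min\{T,R\}+s_B\min\{T,S\}$$ over all choices of non-negative reals $x_{\kappa\kappa_A\kappa_B}$ summing to one is equal to $4/27$.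
   Context: For triples $(\kappa,\kappa_A,\kappa_B),(\lambda,\lambda_A,\lambda_B)\in\{A,B,X\}^3$ write $\kappa\kappa_A\kappa_B\to\lambda\lambda_A\lambda_B$ if each of the pairs $(\kappa,\lambda)$, $(\kappa_A,\lambda_A)$, $(\kappa_B,\lambda_B)$ is one of $(A,B),(A,X),(B,X),(X,A),(X,B),(X,X)$, and moreover $(\kappa_B,\lambda_A)\neq(A,B)$. Each sum above ranges over all pairs of triples satisfying $\to$ and having the displayed fixed coordinates (e.g. in $T$ the first triple has first coordinate $A$ and the second triple has first coordinate $B$; in $R$ the second coordinates are $A$ and $B$; in $S$ the third coordinates are $A$ and $B$). *)

(* Defs.v *)
From HB Require Import structures.
From mathcomp Require Import all_boot all_order all_algebra.
Set Implicit Arguments. Unset Strict Implicit. Unset Printing Implicit Defensive.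
Import Order.TTheory GRing.Theory Num.Theory.

Inductive letter := LA | LB | LX.

Definition letter_to_ord (l : letter) : 'I_3 :=
  match l with LA => inord 0 | LB => inord 1 | LX => inord 2 end.
Definition ord_to_letter (i : 'I_3) : letter :=
  match val i with 0 => LA | 1 => LB | _ => LX end.
Lemma letter_to_ordK : cancel letter_to_ord ord_to_letter.
Proof. by case; rewrite /ord_to_letter /= inordK. Qed.

HB.instance Definition _ := Equality.copy letter (can_type letter_to_ordK).
HB.instance Definition _ := Choice.copy letter (can_type letter_to_ordK).
HB.instance Definition _ := Countable.copy letter (can_type letter_to_ordK).
HB.instance Definition _ := Finite.copy letter (can_type letter_to_ordK).

Definition triple := (letter * letter * letter)%type.
Definition tk  (t : triple) : letter := t.1.1.
Definition tkA (t : triple) : letter := t.1.2.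
Definition tkB (t : triple) : letter := t.2.

Definition okpair (k l : letter) : bool :=
  match k, l with
  | LA, LB | LA, LX | LB, LX | LX, LA | LX, LB | LX, LX => true
  | _, _ => false
  end.

Definition arrow (p q : triple) : bool :=
  [&& okpair (tk p) (tk q), okpair (tkA p) (tkA q), okpair (tkB p) (tkB q)
    & ~~ ((tkB p == LA) && (tkA q == LB))].

Local Open Scope ring_scope.

Section Quantities.
Variable (R : realFieldType) (x : triple -> R).

Definition Tsum : R :=
  \sum_(p : triple) \sum_(q : triple | [&& tk p == LA, tk q == LB & arrow p q])
     x p * x q.
Definition Rsum : R :=
  \sum_(p : triple) \sum_(q : triple | [&& tkA p == LA, tkA q == LB & arrow p q])
     x p * x q.
Definition Ssum : R :=
  \sum_(p : triple) \sum_(q : triple | [&& tkB p == LA, tkB q == LB & arrow p q])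
     x p * x q.
Definition smu (mu : letter) : R := \sum_(a : letter) \sum_(b : letter) x (mu, a, b).

Definition objective : R :=
  smu LX * Tsum + smu LA * Num.min Tsum Rsum + smu LB * Num.min Tsum Ssum.

Definition admissible : Prop := (forall p, 0 <= x p) /\ \sum_(p : triple) x p = 1.
End Quantities.

(* Main.v *)
Require Import Defs.
From mathcomp Require Import all_boot all_order all_algebra.
From mathcomp Require Import reals.
From mathcomp Require Import lra.
Import Order.TTheory GRing.Theory Num.Theory.
Local Open Scope ring_scope.

(** Write [a], [b], [c] for [s_A], [s_B], [s_X] and suppose [b <= a].  Since
    [a min(T,R) <= (a - b) T + b R] and [min(T,S) <= S], the objective is at most
    [(a - b + c) T + b (R + S)]; moreover [T <= a b].  The pairs counted by [R] and [S]
    are disjoint and together form a triangle-free graph in which the vertices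
    with first coordinate [A] are independent.  If [t] is the largest weight of
    an independent set, then [R + S <= t (1 - t)], because every edge has an end
    outside a heaviest independent set and every neighbourhood is independent.
    So if [a >= 1/2], then [R + S <= a (b + c)] and the objective is at most
    [a b (a + 2 c)], which is at most [4/27] by AM-GM on [a], [2 b], [a + 2 c];
    if [a <= 1/2], then [R + S <= 1/4] gives the bound [9/64 < 4/27].
    The case [a <= b] is the same with [A], [R] and [B], [S] exchanged.
    Equality holds for weight [2/3] on [AAX] and [1/3] on [BBX]. *)

(** A weighted form of Mantel's theorem. Asymmetry of [D] makes the double sum count each edge once.
    The [t] produced is the largest weight of an independent set, so it dominates the weight of
    [J]. *)
Lemma sum_edges_triangle_free_le (R : realFieldType) (V : finType) (x : V -> R)
    (D : rel V) (J : {set V}) :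
    (forall v, 0 <= x v) -> \sum_v x v = 1 ->
    (forall u v, D u v -> ~~ D v u) ->
    (forall u v w, D u v || D v u -> D u w || D w u -> ~~ D v w) ->
    {in J &, forall u v, ~~ D u v} ->
  exists2 t, \sum_(v in J) x v <= t &
    \sum_u \sum_(v | D u v) x u * x v <= t * (1 - t).
Proof.
move=> x_ge0 sumx asymD triD indJ.
pose indep (I : {set V}) := [forall u in I, forall v in I, ~~ D u v].
have indepP (I : {set V}) : reflect {in I &, forall u v, ~~ D u v} (indep I).
  apply: (iffP forall_inP) => [H u v uI vI|H u uI].
    by move/forall_inP: (H u uI); apply.
  by apply/forall_inP => v vI; apply: H.
have indJb : indep J by apply/indepP.
pose wt (I : {set V}) := \sum_(v in I) x v.
pose I := [arg max_(I > J | indep I) wt I]%O.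
have [indI maxI] : indep I /\ forall K, indep K -> wt K <= wt I.
  by rewrite /I; case: arg_maxP.
exists (wt I); first exact: maxI.
have sumC : \sum_(v in ~: I) x v = 1 - wt I.
  rewrite -sumx [in RHS](bigID (mem I)) /= -/(wt I) addrAC subrr add0r.
  by apply: eq_bigl => v; rewrite inE.
pose N v := [set u | D v u || D u v].
have wtN v : wt (N v) <= wt I.
  apply/maxI/indepP => u w; rewrite !inE => vu vw; exact: (triD v).
have wtNE v : wt (N v) = \sum_(u | D v u) x u + \sum_(u | D u v) x u.
  rewrite /wt (bigID (D v)) /=; congr (_ + _); apply: eq_bigl => u; rewrite inE.
    by case: (D v u); rewrite ?andbF.
  by case Dvu: (D v u) => /=; rewrite ?andbT // (negPf (asymD _ _ Dvu)).
(* The intermediate sum counts the weight [x u * x v] of an edge once for each of its ends outside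
   [I], hence at least once. *)
apply: (@le_trans _ _ (\sum_(v in ~: I) x v * wt (N v))); last first.
  rewrite -sumC mulrC big_distrl /=; apply: ler_sum => v _.
  exact: ler_wpM2l.
have -> : \sum_(v in ~: I) x v * wt (N v) =
    \sum_u \sum_(v | D u v) ((u \notin I)%:R + (v \notin I)%:R) * (x u * x v).
  under eq_bigr do rewrite wtNE mulrDr !big_distrr /=.
  rewrite big_split /= [X in _ + X](exchange_big_dep predT) //=.
  rewrite [X in X + _]big_mkcond -big_split /=; apply: eq_bigr => u _.
  under [RHS]eq_bigr do rewrite mulrDl.
  rewrite [RHS]big_split /=; congr (_ + _).
    rewrite inE; case: (u \in I) => /=.
      by rewrite big1 // => v _; rewrite mul0r.
    by apply: eq_bigr => v _; rewrite mul1r.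
  rewrite big_mkcondl /=; apply: eq_bigr => v _; rewrite inE.
  by case: (v \in I); rewrite ?mul0r // mul1r mulrC.
apply: ler_sum => u _; apply: ler_sum => v Duv.
rewrite -{1}[x u * x v]mul1r; apply: ler_wpM2r; first exact: mulr_ge0.
have : (u \notin I) || (v \notin I).
  rewrite -negb_and; apply: contraL Duv => /andP[uI vI].
  exact: (indepP _ indI).
by case: (u \notin I); case: (v \notin I) => //= _; rewrite ?addr0 ?add0r // lerDl.
Qed.

Lemma sum_pairs_le (R : realFieldType) (V : finType) (x : V -> R) (P : rel V)
    (A B : pred V) : (forall p, 0 <= x p) ->
  (forall p q, P p q -> A p && B q) ->
  \sum_p \sum_(q | P p q) x p * x q <= (\sum_(p | A p) x p) * (\sum_(q | B q) x q).
Proof.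
move=> x_ge0 PAB; rewrite big_distrlr /= [leRHS]big_mkcond /=.
apply: ler_sum => p _; case: ifP => Ap.
  rewrite [leLHS]big_mkcond [leRHS]big_mkcond /=; apply: ler_sum => q _.
  have xx : 0 <= x p * x q by apply: mulr_ge0.
  case: ifP => [/PAB/andP[_ ->]//|_]; by case: ifP.
by rewrite big1 // => q /PAB; rewrite Ap.
Qed.

Lemma smuE (R : realFieldType) (x : triple -> R) mu :
  smu x mu = \sum_(p | tk p == mu) x p.
Proof.
rewrite /smu pair_big /= (reindex (fun ab => (mu, ab.1, ab.2))) /=; last first.
  exists (fun p : triple => (p.1.2, p.2)) => [[a b]|[[k a] b]] //=.
  by rewrite inE /tk /= => /eqP ->.
by apply: eq_bigl => ab; rewrite /tk /= eqxx.
Qed.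

Lemma letter_eqE (k l : letter) :
  (k == l) = match k, l with LA, LA | LB, LB | LX, LX => true | _, _ => false end.
Proof. by apply/eqP; case: k; case: l. Qed.

Lemma sum_smu (R : realFieldType) (x : triple -> R) :
  smu x LA + smu x LB + smu x LX = \sum_p x p.
Proof.
rewrite !smuE [RHS](bigID (fun p => tk p == LA)) /= -addrA; congr (_ + _).
rewrite [RHS](bigID (fun p => tk p == LB)) /=; congr (_ + _); apply: eq_bigl;
by case=> [[[] a] b]; rewrite /tk /= !letter_eqE.
Qed.

Definition RSedge (p q : triple) : bool :=
  [&& tkA p == LA, tkA q == LB & arrow p q] ||
  [&& tkB p == LA, tkB q == LB & arrow p q].

(** No pair is counted twice: one in both sums would have [tkB p = LA] and [tkA q = LB], which
    [arrow] forbids. *)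
Lemma RsumDSsum (R : realFieldType) (x : triple -> R) :
  Rsum x + Ssum x = \sum_p \sum_(q | RSedge p q) x p * x q.
Proof.
rewrite -big_split /=; apply: eq_bigr => p _.
rewrite [RHS](bigID (fun q => [&& tkA p == LA, tkA q == LB & arrow p q])) /=.
congr (_ + _); apply: eq_bigl => q; rewrite /RSedge.
  by case: [&& tkA p == _, _ & _]; rewrite ?andbF.
case: p q => [[k a] b] [[k' a'] b']; rewrite /arrow /tk /tkA /tkB /= !letter_eqE.
by case: (okpair k k'); case: a b a' b' => [] [] [] [].
Qed.

(* The conditions that [RSedge] imposes on the last two coordinates. *)
Definition RSedge2 (a b a' b' : letter) : bool :=
  match a, b, a', b' with
  | LA, LB, LB, LX | LA, LX, LB, _ | _, LA, LX, LB | LX, LA, LA, LB => true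
  | _, _, _, _ => false
  end.

Lemma RSedgeW p q : RSedge p q ->
  okpair (tk p) (tk q) && RSedge2 (tkA p) (tkB p) (tkA q) (tkB q).
Proof.
case: p q => [[k a] b] [[k' a'] b'].
rewrite /RSedge /arrow /tk /tkA /tkB /= !letter_eqE.
by case: (okpair k k'); case: a b a' b' => [] [] [] [].
Qed.

Lemma RSedge_asym p q : RSedge p q -> ~~ RSedge q p.
Proof.
move=> /RSedgeW/andP[_ pq]; apply/negP => /RSedgeW/andP[_]; move: pq.
by case: (tkA p) (tkB p) (tkA q) (tkB q) => [] [] [] [].
Qed.

(** Forgetting directions, [RSedge2] is the hexagon [AB], [BX], [AX], [BA], [XB], [XA] on the last
    two coordinates, with [BB] hanging from [AX] and [AA] from [XB], and [XX] isolated. A triangle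
    of [RSedge] would project to a triangle there. *)
Lemma RSedge_triangle_free p q r :
  RSedge p q || RSedge q p -> RSedge p r || RSedge r p -> ~~ RSedge q r.
Proof.
move=> pq pr; apply/negP => /RSedgeW/andP[_ qr].
have {pq} : RSedge2 (tkA p) (tkB p) (tkA q) (tkB q) ||
    RSedge2 (tkA q) (tkB q) (tkA p) (tkB p).
  by case/orP: pq => /RSedgeW/andP[_ ->]; rewrite ?orbT.
have {pr} : RSedge2 (tkA p) (tkB p) (tkA r) (tkB r) ||
    RSedge2 (tkA r) (tkB r) (tkA p) (tkB p).
  by case/orP: pr => /RSedgeW/andP[_ ->]; rewrite ?orbT.
move: qr.
by case: (tkA q) (tkB q) (tkA r) (tkB r) => [] [] [] [] //=;
  case: (tkA p) (tkB p) => [] [].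
Qed.

(** The only diagonal pair that [okpair] accepts is [(LX, LX)], so for the other two letters the
    triples starting with [mu] are independent. *)
Lemma RsumDSsum_le (R : realFieldType) (x : triple -> R) mu :
  admissible x -> mu != LX ->
  exists2 t, smu x mu <= t & Rsum x + Ssum x <= t * (1 - t).
Proof.
move=> [x_ge0 sumx] muX.
have [|t] := @sum_edges_triangle_free_le R _ x RSedge [set p | tk p == mu]
    x_ge0 sumx RSedge_asym RSedge_triangle_free.
  move=> p q; rewrite !inE => /eqP pmu /eqP qmu; apply/negP => /RSedgeW/andP[+ _].
  by rewrite pmu qmu; move: muX; rewrite letter_eqE; case: (mu).
rewrite RsumDSsum smuE => Ht Hs; exists t => //.
by rewrite (le_trans _ Ht) //; under [leRHS]eq_bigl do rewrite inE.
Qed.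

Lemma amgm_cubic_le (R : realFieldType) (a b : R) :
  0 <= a -> a <= 1 -> a * b * (2 - a - 2 * b) <= 4 / 27.
Proof.
move=> a0 a1.
(* The gap between the two sides is [h1 / 8 + h2 / 216] in terms of the quantities bounded here;
   both vanish at [a = 2 / 3], [b = 1 / 3]. *)
have h1 : 0 <= a * (2 - a - 4 * b) ^+ 2 by rewrite mulr_ge0 ?sqr_ge0.
have h2 : 0 <= (8 - 3 * a) * (3 * a - 2) ^+ 2.
  by rewrite mulr_ge0 ?sqr_ge0 // subr_ge0; lra.
nra.
Qed.

(** Stated for bare numbers so that it also applies with [a], [r] and [b], [s] standing for the data
    of [LB] and [LA]. *)
Lemma objective_bound (R : realFieldType) (a b c T r s t : R) :
  0 <= b -> b <= a -> 0 <= c -> a + b + c = 1 -> T <= a * b ->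
  a <= t -> r + s <= t * (1 - t) ->
  c * T + a * Num.min T r + b * Num.min T s <= 4 / 27.
Proof.
move=> b0 ba c0 abc Tab at_ rs.
have min1 : a * Num.min T r <= (a - b) * T + b * r.
  rewrite -{1}[a](subrK b) mulrDl lerD // ler_wpM2l ?subr_ge0 //.
    by rewrite ge_min lexx.
  by rewrite ge_min lexx orbT.
have min2 : b * Num.min T s <= b * s.
  by rewrite ler_wpM2l // ge_min lexx orbT.
have step : c * T + a * Num.min T r + b * Num.min T s
    <= (a - b + c) * (a * b) + b * (t * (1 - t)).
  have h1 : (a - b + c) * T <= (a - b + c) * (a * b) by rewrite ler_wpM2l //; lra.
  have h2 : b * (r + s) <= b * (t * (1 - t)) by rewrite ler_wpM2l.
  lra.
apply: (le_trans step).
have [a_half|a_half] := lerP (1 / 2) a.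
  (* The function [t * (1 - t)] decreases from [1 / 2] on, and [a <= t]. *)
  have h : b * (t * (1 - t)) <= b * (a * (1 - a)).
    by rewrite ler_wpM2l // -subr_ge0; nra.
  have : a * b * (2 - a - 2 * b) <= 4 / 27 by apply: amgm_cubic_le; lra.
  have -> : c = 1 - a - b by lra.
  nra.
have h : b * (t * (1 - t)) <= b * (1 / 4).
  by rewrite ler_wpM2l //; have := sqr_ge0 (t - 1 / 2); nra.
have h2 : (a - b + c) * (a * b) <= (a - b + c) * (b / 2).
  by rewrite ler_wpM2l; [|lra|nra].
(* Since [a - b + c = 1 - 2 * b], the bound has become [b * (3 / 4 - b)], whose maximum [9 / 64] is
   at [b = 3 / 8]. *)
have := sqr_ge0 (b - 3 / 8).
have -> : c = 1 - a - b by lra.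
nra.
Qed.

(** Evaluates sums at the extremal weight: [F] is an indicator for single sums and an inner sum for
    double ones. *)
Lemma sum_two_points (R : realFieldType) (V : finType) (u w : V) (c d : R)
    (F : V -> R) : u != w ->
  \sum_p (if p == u then c else if p == w then d else 0) * F p = c * F u + d * F w.
Proof.
move=> uw; rewrite (bigD1 u) //= eqxx; congr (_ + _).
have wu : (w == u) = false by rewrite eq_sym (negPf uw).
rewrite (bigD1 w) ?wu //= eqxx big1 ?addr0 //.
by move=> p /andP[/negPf-> /negPf->]; rewrite mul0r.
Qed.

(* maximum = 4/27: an upper bound that is attained *)
Theorem theorem6p4 (R : realType) :
  (forall x : triple -> R, admissible x -> objective x <= 4%:R / 27%:R) /\
  (exists x : triple -> R, admissible x /\ objective x = 4%:R / 27%:R).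
Proof.
split=> [x adm|].
  have [x_ge0 sumx] := adm.
  have smu_ge0 mu : 0 <= smu x mu by rewrite smuE sumr_ge0.
  have abc : smu x LA + smu x LB + smu x LX = 1 by rewrite sum_smu.
  have Tab : Tsum x <= smu x LA * smu x LB.
    rewrite !smuE; apply: sum_pairs_le => // p q /and3P[-> -> _] //.
  have [|t at_ rs] := @RsumDSsum_le R x LA adm; first by rewrite letter_eqE.
  have [|t' bt rs'] := @RsumDSsum_le R x LB adm; first by rewrite letter_eqE.
  have [ab|/ltW ba] := lerP (smu x LB) (smu x LA).
    by apply: (@objective_bound R _ _ _ _ _ _ t).
  rewrite /objective -addrA [X in _ + X]addrC addrA.
  apply: (@objective_bound R _ _ _ _ _ _ t') => //.
  - by rewrite [smu x LB + _]addrC.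
  - by rewrite mulrC.
  - by rewrite addrC.
pose u : triple := (LA, LA, LX); pose w : triple := (LB, LB, LX).
pose x p : R := if p == u then 2 / 3 else if p == w then 1 / 3 else 0.
have uw : u != w by apply/eqP.
have sum_x (P : pred triple) :
    \sum_(p | P p) x p = 2 / 3 * (P u)%:R + 1 / 3 * (P w)%:R.
  rewrite -(@sum_two_points R _ u w _ _ (fun p => (P p)%:R)) // big_mkcond /=.
  by apply: eq_bigr => p _; case: (P p); rewrite ?mulr1 ?mulr0.
have sum_xx (P : rel triple) : \sum_p \sum_(q | P p q) x p * x q =
    2 / 3 * (2 / 3 * (P u u)%:R + 1 / 3 * (P u w)%:R) +
    1 / 3 * (2 / 3 * (P w u)%:R + 1 / 3 * (P w w)%:R).
  rewrite -!sum_x -(@sum_two_points R _ u w _ _ (fun p => \sum_(q | P p q) x q)) //.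
  by apply: eq_bigr => p _; rewrite big_distrr.
exists x; split.
  split=> [p|]; last by rewrite sum_x /=; lra.
  by rewrite /x; do 2?case: ifP => _; lra.
(* The only arrow between the two points, from [u] to [w], counts for [Tsum] and [Rsum] but not for
   [Ssum]. Both of the former are [2 / 9], and the value is [2 / 3 * (2 / 9)]. *)
rewrite /objective !smuE /Tsum /Rsum /Ssum !sum_xx !sum_x.
rewrite /arrow /tk /tkA /tkB /= !letter_eqE /=.
rewrite !mulr0n !mulr1n !(mulr0, mulr1, addr0, add0r, mul0r) minxx.
have -> : Num.min (2 / 3 * (1 / 3)) 0 = 0 :> R by apply: min_r; lra.
lra.
Qed.
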